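(* Let $w_1,w_2\in(0,1)$ with $w_1=w_2$, let $f,g\colon[0,1]\to[-\infty,\infty]$ be strictly monotone continuous functions, and let $\mathrm{K}_{w_1}^{f}$ and $\mathrm{K}_{w_2}^{g}$ be the quasi-linear means generated by $f$ and $g$. Set $\widehat f=f|_{(0,1)}$, $\widehat g=g|_{(0,1)}$ and $\widehat h=\widehat g\circ\widehat f^{-1}$ (defined on $\operatorname{Ran}(\widehat f)$). Then the pair $(\mathrm{K}_{w_1}^{f},\mathrm{K}_{w_2}^{g})$ is admissible if and only if $\min\{|f(0)|,|g(0)|\}<\infty$, $\min\{|f(1)|,|g(1)|\}<\infty$, and $\widehat h$ is strictly convex or strictly concave.
   Context: Let $\mathsf{Int}_{[0,1]}=\{[a_1,a_2]: 0\le a_1\le a_2\le 1\}$ (degenerate intervals allowed); write $\mathbf u=[u_1,u_2]$. The interval order is: $\mathbf u\preceq_{\mathrm{Int}}\mathbf x$ iff $u_1\le x_1$ and $u_2\le x_2$. An admissible order is a total order $\preceq$ on $\mathsf{Int}_{[0,1]}$ such that $\mathbf u\preceq_{\mathrm{Int}}\mathbf x$ implies $\mathbf u\preceq\mathbf x$. An aggregation function (AF) is a function $\mathrm A\colon\mathsf{Int}_{[0,1]}\to[0,1]$ with $\mathrm A([0,0])=0$, $\mathrm A([1,1])=1$, and $\mathrm A(\mathbf u)\le\mathrm A(\mathbf x)$ whenever $u_1\le x_1$ and $u_2\le x_2$. For a pair $(\mathrm A,\mathrm B)$ of AFs, the relation $\preceq_{\mathrm A,\mathrm B}$ is defined by: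 $\mathbf u\preceq_{\mathrm A,\mathrm B}\mathbf x$ iff $\mathrm A(\mathbf u)<\mathrm A(\mathbf x)$, or $\mathrm A(\mathbf u)=\mathrm A(\mathbf x)$ and $\mathrm B(\mathbf u)\le\mathrm B(\mathbf x)$. The pair $(\mathrm A,\mathrm B)$ is admissible if $\preceq_{\mathrm A,\mathrm B}$ is an admissible order. For $w\in(0,1)$ and a strictly monotone continuous $f\colon[0,1]\to[-\infty,\infty]$, the quasi-linear mean generated by $f$ is $\mathrm K_w^f\colon\mathsf{Int}_{[0,1]}\to[0,1]$, $\mathrm K_w^f([z_1,z_2])=f^{-1}\big((1-w)f(z_1)+wf(z_2)\big)$, with the convention $-\infty+\infty=\infty-\infty=-\infty$, where $f^{-1}$ is the inverse of $f$ on its range $\operatorname{Ran}(f)$. *)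

(* Defs.v *)
From mathcomp Require Export all_boot all_order all_algebra.
From mathcomp Require Export all_classical all_reals all_analysis.

Set Implicit Arguments.
Unset Strict Implicit.
Unset Printing Implicit Defensive.

Import Order.TTheory GRing.Theory Num.Theory.
Import numFieldNormedType.Exports.

Local Open Scope classical_set_scope.
Local Open Scope ring_scope.

Definition Int01 (R : realType) :=
  {z : R * R | [&& 0 <= z.1, z.1 <= z.2 & z.2 <= 1]}.

Section Intervals.
Variable R : realType.
Implicit Types (u x : Int01 R) (A B : Int01 R -> R).

Definition lo u : R := (val u).1.
Definition hi u : R := (val u).2.

Lemma diag_subproof (c : R) : 0 <= c <= 1 ->
  [&& 0 <= (c, c).1, (c, c).1 <= (c, c).2 & (c, c).2 <= 1].
Proof. by move=> /andP[c0 c1]; rewrite /= c0 lexx c1. Qed.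

Lemma zero_subproof : 0 <= (0 : R) <= 1.
Proof. by rewrite lexx ler01. Qed.

Lemma one_subproof : 0 <= (1 : R) <= 1.
Proof. by rewrite lexx ler01. Qed.

Definition Int01_0 : Int01 R := exist _ (0, 0) (diag_subproof zero_subproof).
Definition Int01_1 : Int01 R := exist _ (1, 1) (diag_subproof one_subproof).

Definition le_Int u x : bool := (lo u <= lo x) && (hi u <= hi x).

Definition admissible_order (r : rel (Int01 R)) : Prop :=
  [/\ reflexive r, antisymmetric r, transitive r, total r
    & forall u x, le_Int u x -> r u x].

Definition aggregation_function A : Prop :=
  [/\ forall u, 0 <= A u <= 1,
      A Int01_0 = 0,
      A Int01_1 = 1
    & forall u x, le_Int u x -> A u <= A x].

Definition le_pair A B : rel (Int01 R) :=
  fun u x => (A u < A x) || ((A u == A x) && (B u <= B x)).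

Definition admissible_pair A B : Prop :=
  [/\ aggregation_function A, aggregation_function B
    & admissible_order (le_pair A B)].

End Intervals.

(* A map [0,1] -> [-oo,+oo] is represented by a total function f on R, of which
   only the values on [0,1] matter. *)
Section Generators.
Variable R : realType.
Implicit Types (w : R) (f g : R -> \bar R) (h : R -> R) (D : set R).

(* [adde] satisfies -oo + +oo = +oo + -oo = -oo.  The default value 0 of
   the partial inverse is taken only outside f @` `[0, 1]. *)
Definition quasi_linear_mean w f (u : Int01 R) : R :=
  'pinv_(fun=> 0) `[0, 1] f ((1 - w)%:E * f (lo u) + w%:E * f (hi u))%E.

(* A strictly monotone f is finite on ]0,1[, so the restriction of f to ]0,1[
   is real-valued and [fine] loses nothing there. *)
Definition hat f : R -> R := fun x => fine (f x).

Definition hat_range f : set R := hat f @` `]0, 1[.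

Definition hat_comp g f : R -> R :=
  fun y => hat g ('pinv_(fun=> 0) `]0, 1[ (hat f) y).

Definition strictly_convex_on D h : Prop :=
  forall x y t, D x -> D y -> x != y -> 0 < t < 1 ->
    h ((1 - t) * x + t * y) < (1 - t) * h x + t * h y.

Definition strictly_concave_on D h : Prop :=
  forall x y t, D x -> D y -> x != y -> 0 < t < 1 ->
    (1 - t) * h x + t * h y < h ((1 - t) * x + t * y).

End Generators.

(* Main.v *)
Require Import Defs.
From mathcomp Require Import all_boot all_order all_algebra.
From mathcomp Require Import all_classical all_reals all_analysis.
From mathcomp Require Import unstable ring lra.
Set Implicit Arguments.
Unset Strict Implicit.
Import Order.TTheory GRing.Theory Num.Theory.
Import numFieldNormedType.Exports.
Local Open Scope classical_set_scope.
Local Open Scope ring_scope.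

(* A lexicographic order is always a total preorder, so the pair is admissible
   iff the two means are jointly injective. With [F u = (1 - w) f(u_1) + w f(u_2)]
   and [G] likewise, this says that [F u = F x] and [G u = G x] force [u = x].

   If the pair is admissible, comparing a degenerate interval [[c, c]] with
   [[a, b]], [a < b], shows that [h = g o f^-1] never agrees with its chord over
   [f a, f b] at the weight [w]; by connectedness of the set of pairs [a < b] it
   always lies on the same side of it. A continuous function lying strictly below
   all its chords at one weight is strictly convex: otherwise its difference with
   an affine function has an interior maximum. Comparing intervals with a common
   end [0] (or [1]) shows that [f] and [g] are not both infinite there.

   Conversely, if [F u = F x] is infinite, then [u] and [x] share the end [0] or
   the end [1]. If [F u = F x] and [G u = G x] are finite and [u <> x], then one
   interval is strictly inside the other one, and strict convexity, extended to
   the closed interval by the same maximum argument, gives [G u <> G x]. *)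

(** * Strictly monotone functions on an interval *)

Lemma strict_monotonicS (R : realType) d (T : porderType d) (A B : interval R)
    (f : R -> T) :
  {subset A <= B} -> strict_monotonic B f -> strict_monotonic A f.
Proof.
by move=> AB [] f_mono; [left|right] => x y /AB xB /AB yB; exact: f_mono.
Qed.

Lemma strict_monotonic_inj (R : realType) d (T : porderType d) (A : interval R)
    (f : R -> T) : strict_monotonic A f -> {in A &, injective f}.
Proof.
by case=> f_mono x y xA yA fxy; case: (ltgtP x y) => // xy;
  first [have := f_mono _ _ xA yA xy | have := f_mono _ _ yA xA xy];
  rewrite fxy ltxx.
Qed.

(** * Chords of [psi] relative to [phi] *)

Section Chord.
Variable R : realType.
Implicit Types (p q s t w : R) (phi psi : R -> R).

(* Only the pairs [a < b] and the one weight [w] occur, because these are what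
   the mean of weight [w] of an interval [[a, b]] involves. *)
Definition convex_wrt (w : R) (A : interval R) (phi psi : R -> R) : Prop :=
  forall a b c, a \in A -> b \in A -> c \in A -> a < b ->
    phi c = (1 - w) * phi a + w * phi b ->
    psi c < (1 - w) * psi a + w * psi b.

Lemma IVT_conv phi p q t : p < q -> {within `[p, q], continuous phi} ->
  0 < t < 1 -> exists2 z, z \in `[p, q] & phi z = (1 - t) * phi p + t * phi q.
Proof.
move=> pq phi_cont /andP[t0 t1]; apply: IVT => //; first exact: ltW.
have t'0 : 0 <= t by exact: ltW.
have t'1 : 0 <= 1 - t by rewrite subr_ge0 ltW.
rewrite minEle maxEle; case: ifPn => pq'; last first.
  have {}pq' : phi q <= phi p by rewrite ltW// ltNge.
  by have := ler_wpM2l t'0 pq'; have := ler_wpM2l t'1 pq'; lra.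
by have := ler_wpM2l t'0 pq'; have := ler_wpM2l t'1 pq'; lra.
Qed.

Lemma strict_monotonic_between phi p q z :
    strict_monotonic `[p, q] phi -> z \in `]p, q[ ->
  exists2 t, 0 < t < 1 & phi z = (1 - t) * phi p + t * phi q.
Proof.
move=> phi_mono; rewrite in_itv/= => /andP[pz zq].
have pq := lt_trans pz zq.
have pI : p \in `[p, q] by rewrite in_itv/= lexx ltW.
have qI : q \in `[p, q] by rewrite in_itv/= lexx ltW.
have zI : z \in `[p, q] by rewrite in_itv/= !ltW.
exists ((phi z - phi p) / (phi q - phi p)); last first.
  have : phi q - phi p != 0.
    rewrite subr_eq0; apply/eqP => /(strict_monotonic_inj phi_mono) qp.
    by move: pq; rewrite qp ?ltxx.
  by move=> ?; field.
case: phi_mono => phi_mono.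
- have := phi_mono _ _ pI zI pz; have := phi_mono _ _ zI qI zq => zq' pz'.
  by rewrite divr_gt0 ?ltr_pdivrMr; lra.
- have := phi_mono _ _ zI pI pz; have := phi_mono _ _ qI zI zq => zq' pz'.
  by rewrite -mulrNN -invrN divr_gt0 ?ltr_pdivrMr; lra.
Qed.

(** The weight of a point on the chord of [phi] grows from [p] to [q] whether [phi] increases or
    decreases; this orders points known only by their weights. *)
Lemma strict_monotonic_conv_lt phi p q s t a b :
    strict_monotonic `[p, q] phi -> p < q -> 0 < s -> s < t -> t < 1 ->
    a \in `[p, q] -> b \in `[p, q] ->
    phi a = (1 - s) * phi p + s * phi q -> phi b = (1 - t) * phi p + t * phi q ->
  p < a < b /\ b < q.
Proof.
move=> phi_mono pq s0 st t1 aI bI phia phib.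
have pI : p \in `[p, q] by rewrite in_itv/= lexx ltW.
have qI : q \in `[p, q] by rewrite in_itv/= lexx ltW.
case: phi_mono => phi_mono.
- have : 0 < phi q - phi p by rewrite subr_gt0; exact: phi_mono.
  move=> phi_pq.
  have lt_of x y : x \in `[p, q] -> y \in `[p, q] -> phi x < phi y -> x < y.
    move=> xI yI; have [//|yx|->] := ltgtP x y; last by rewrite ltxx.
    by rewrite ltNge (ltW (phi_mono _ _ yI xI yx)).
  (split; [apply/andP; split|]); apply: lt_of => //; rewrite -subr_gt0 ?phia ?phib.
  - by rewrite (_ : _ - _ = s * (phi q - phi p)) ?mulr_gt0//; ring.
  - by rewrite (_ : _ - _ = (t - s) * (phi q - phi p)) ?mulr_gt0//; [lra|ring].
  - by rewrite (_ : _ - _ = (1 - t) * (phi q - phi p)) ?mulr_gt0//; [lra|ring].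
- have : 0 < phi p - phi q by rewrite subr_gt0; exact: phi_mono.
  move=> phi_pq.
  have lt_of x y : x \in `[p, q] -> y \in `[p, q] -> phi y < phi x -> x < y.
    move=> xI yI; have [//|yx|->] := ltgtP x y; last by rewrite ltxx.
    by rewrite ltNge (ltW (phi_mono _ _ xI yI yx)).
  (split; [apply/andP; split|]); apply: lt_of => //; rewrite -subr_gt0 ?phia ?phib.
  - by rewrite (_ : _ - _ = s * (phi p - phi q)) ?mulr_gt0//; ring.
  - by rewrite (_ : _ - _ = (t - s) * (phi p - phi q)) ?mulr_gt0//; [lra|ring].
  - by rewrite (_ : _ - _ = (1 - t) * (phi p - phi q)) ?mulr_gt0//; [lra|ring].
Qed.

(* Otherwise [psi] minus the affine function of [phi] interpolating it at [p]
   and [q] attains its maximum over [`[p, q]] at an interior point [c], which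
   contradicts the hypothesis for [a] and [b] around [c]. *)
Lemma chord_lt phi psi p q w : p < q -> 0 < w < 1 ->
    strict_monotonic `[p, q] phi ->
    {within `[p, q], continuous phi} -> {within `[p, q], continuous psi} ->
    convex_wrt w `]p, q[ phi psi ->
  forall z t, z \in `]p, q[ -> phi z = (1 - t) * phi p + t * phi q ->
    psi z < (1 - t) * psi p + t * psi q.
Proof.
move=> pq /andP[w0 w1] phi_mono phi_cont psi_cont psi_lt z t zI phiz.
rewrite ltNge; apply/negP => chord_le.
have pI : p \in `[p, q] by rewrite in_itv/= lexx ltW.
have qI : q \in `[p, q] by rewrite in_itv/= lexx ltW.
have phi_neq : phi q - phi p != 0.
  rewrite subr_eq0; apply/eqP => /(strict_monotonic_inj phi_mono) qp.
  by move: pq; rewrite qp ?ltxx.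
(* The slope that makes [k p = k q]. *)
pose alpha := (psi q - psi p) / (phi q - phi p).
pose k x := psi x - alpha * phi x.
have kpq : k q = k p by rewrite /k /alpha; field.
have kz : k p <= k z.
  have -> : k z = k p + (psi z - ((1 - t) * psi p + t * psi q)).
    by rewrite /k phiz /alpha; field.
  by rewrite lerDl subr_ge0.
have k_cont : {within `[p, q], continuous k}.
  move=> x; apply: cvgB; first exact: psi_cont.
  by apply: cvgM; [exact: cvg_cst|exact: phi_cont].
(* A maximum at an end equals [k p = k q <= k z], so [z] is then an interior maximizer. *)
have [c cI cmax] : exists2 c, c \in `]p, q[ & forall x, x \in `[p, q] -> k x <= k c.
  have [m mI mmax] := EVT_max (ltW pq) k_cont.
  have [mI'|] := boolP (m \in `]p, q[); first by exists m.
  move=> mNI; exists z => // x /mmax/le_trans; apply; apply: le_trans kz.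
  have /orP[/eqP->|/eqP->] // : (m == p) || (m == q); last by rewrite kpq.
  move: mI mNI; rewrite !in_itv/= => /andP[pm mq].
  by rewrite negb_and -!leNgt !eq_le pm mq/= => /orP[]->; rewrite ?orbT.
have [s /andP[s0 s1] phic] := strict_monotonic_between phi_mono cI.
(* With this [e], the weights [s - w * e] and [s + (1 - w) * e] stay strictly between 0 and 1, and
   their mean of weight [w] is [s]. *)
pose e := Num.min s (1 - s).
have e0 : 0 < e by rewrite lt_min s0 subr_gt0.
have es : e <= s by rewrite ge_min lexx.
have es1 : e <= 1 - s by rewrite ge_min lexx orbT.
have s'0 : 0 < s - w * e by rewrite subr_gt0 (lt_le_trans _ es)// gtr_pMl.
have s't : s - w * e < s + (1 - w) * e by lra.
have t'1 : s + (1 - w) * e < 1.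
  by rewrite -ltrBrDl (lt_le_trans _ es1)// gtr_pMl// gtrBl.
have [|a aI phia] := @IVT_conv phi p q (s - w * e) pq phi_cont; first by lra.
have [|b bI phib] := @IVT_conv phi p q (s + (1 - w) * e) pq phi_cont; first by lra.
have [/andP[pa ab] bq] :=
  strict_monotonic_conv_lt phi_mono pq s'0 s't t'1 aI bI phia phib.
have phicE : phi c = (1 - w) * phi a + w * phi b by rewrite phic phia phib; ring.
have psic : psi c < (1 - w) * psi a + w * psi b.
  by apply: psi_lt => //; rewrite in_itv/= ?pa ?bq/= ?(lt_trans ab) ?(lt_trans pa).
have : k c < (1 - w) * k a + w * k b.
  rewrite -subr_gt0.
  have -> : (1 - w) * k a + w * k b - k c = (1 - w) * psi a + w * psi b - psi c.
    by rewrite /k phicE; ring.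
  by rewrite subr_gt0.
have -> : k c = (1 - w) * k c + w * k c by ring.
by apply/negP; rewrite -leNgt lerD// ler_pM2l ?subr_gt0// cmax.
Qed.

(** Let [s], [t] be the weights of [x], [y] on the chord of [phi]. Equality of the [phi] sums forces
    [(1 - w) * s + w * t = w], so the chord inequalities for [psi] at [x] and [y] add up to the
    claim. *)
Lemma convex_wrt_nested phi psi w (p q x y : R) : 0 < w < 1 -> p < x -> x <= y -> y < q ->
    strict_monotonic `[p, q] phi ->
    {within `[p, q], continuous phi} -> {within `[p, q], continuous psi} ->
    convex_wrt w `]p, q[ phi psi ->
    (1 - w) * phi p + w * phi q = (1 - w) * phi x + w * phi y ->
  (1 - w) * psi x + w * psi y < (1 - w) * psi p + w * psi q.
Proof.
move=> w01 px xy yq phi_mono phi_cont psi_cont psi_below phi_eq.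
have pq : p < q by lra.
have xI : x \in `]p, q[ by rewrite in_itv/=; apply/andP; split; lra.
have yI : y \in `]p, q[ by rewrite in_itv/=; apply/andP; split; lra.
have pI : p \in `[p, q] by rewrite in_itv/= lexx ltW.
have qI : q \in `[p, q] by rewrite in_itv/= lexx ltW.
have [s _ phix] := strict_monotonic_between phi_mono xI.
have [t _ phiy] := strict_monotonic_between phi_mono yI.
have chord := chord_lt pq w01 phi_mono phi_cont psi_cont psi_below.
have := chord _ _ xI phix; have := chord _ _ yI phiy => psiy psix.
have phi_neq : phi q - phi p != 0.
  rewrite subr_eq0; apply/eqP => /(strict_monotonic_inj phi_mono) qp.
  by move: pq; rewrite qp ?ltxx.
have st : (1 - w) * s + w * t = w.
  by apply: (mulIf phi_neq); move: phi_eq; rewrite phix phiy; lra.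
have [w0 w1] : 0 < w /\ 0 < 1 - w by lra.
have -> : (1 - w) * psi p + w * psi q =
  (1 - w) * ((1 - s) * psi p + s * psi q) + w * ((1 - t) * psi p + t * psi q).
  by rewrite -{1 2}st; ring.
by rewrite ltrD// ltr_pM2l.
Qed.

End Chord.

(** * Intervals and weighted sums of generator values *)

Section QuasiLinear.
Variable R : realType.
Implicit Types (f : R -> \bar R) (w : R) (u x : Int01 R).

Lemma Int01P u : [/\ 0 <= lo u, lo u <= hi u & hi u <= 1].
Proof. by have /and3P[] := valP u. Qed.

Lemma lo_in01 u : lo u \in `[0, 1].
Proof. by have [? ? ?] := Int01P u; rewrite in_itv/=; apply/andP; split; lra. Qed.

Lemma hi_in01 u : hi u \in `[0, 1].
Proof. by have [? ? ?] := Int01P u; rewrite in_itv/=; apply/andP; split; lra. Qed.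

Lemma Int01_eq u x : lo u = lo x -> hi u = hi x -> u = x.
Proof.
by rewrite /lo /hi => lo_eq hi_eq; apply: val_inj;
  rewrite [val u]surjective_pairing lo_eq hi_eq -surjective_pairing.
Qed.

Lemma Int01_ex (a b : R) : 0 <= a -> a <= b -> b <= 1 ->
  exists u : Int01 R, lo u = a /\ hi u = b.
Proof.
move=> a0 ab b1; have abP : [&& 0 <= (a, b).1, (a, b).1 <= (a, b).2 & (a, b).2 <= 1].
  by rewrite /= a0 ab.
by exists (exist _ (a, b) abP).
Qed.

(** The image under [f] of the quasi-linear mean, by [qlm_spec]; working with it avoids the partial
    inverse. *)
Definition wsum w f u : \bar R :=
  ((1 - w)%:E * f (lo u) + w%:E * f (hi u))%E.

Lemma fin_num_pmulE (r : R) (y : \bar R) : 0 < r ->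
  ((r%:E * y)%E \is a fin_num) = (y \is a fin_num).
Proof.
by move=> r0; case: y => [y| |]//; rewrite ?gt0_muley ?gt0_muleNy ?lte_fin.
Qed.

Section wsum.
Variables (w : R) (w01 : 0 < w < 1).

Let w_gt0 : 0 < w. Proof. by case/andP: w01. Qed.
Let w'_gt0 : 0 < 1 - w. Proof. by rewrite subr_gt0; case/andP: w01. Qed.

Lemma wsum_fin_num f u : (wsum w f u \is a fin_num) =
  (f (lo u) \is a fin_num) && (f (hi u) \is a fin_num).
Proof. by rewrite fin_numD !fin_num_pmulE. Qed.

Lemma wsum_fine f u : f (lo u) \is a fin_num -> f (hi u) \is a fin_num ->
  wsum w f u = ((1 - w) * hat f (lo u) + w * hat f (hi u))%:E.
Proof.
by move=> flo fhi; rewrite /wsum /hat -(fineK flo) -(fineK fhi).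
Qed.

Lemma wsum_diag f u : lo u = hi u -> wsum w f u = f (lo u).
Proof.
rewrite /wsum => <-; case: (f (lo u)) => [r| |].
- by rewrite -!EFinM -EFinD; congr EFin; ring.
- by rewrite !gt0_muley ?lte_fin.
- by rewrite !gt0_muleNy ?lte_fin.
Qed.

(** Positive weights preserve infinite values, and opposite infinities add up to [-oo], which is one
    of the two. *)
Lemma wsum_infty f u : wsum w f u \isn't a fin_num ->
  wsum w f u = f (lo u) \/ wsum w f u = f (hi u).
Proof.
rewrite wsum_fin_num negb_and /wsum.
case: (f (lo u)) => [r| |]; case: (f (hi u)) => [s| |];
  rewrite ?gt0_muley ?gt0_muleNy ?lte_fin//=; by [left|right].
Qed.

Lemma le_wsum f u x : (f (lo u) <= f (lo x))%E -> (f (hi u) <= f (hi x))%E ->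
  (wsum w f u <= wsum w f x)%E.
Proof. by move=> lo_le hi_le; rewrite leeD// lee_pmul2l. Qed.

End wsum.

(** * Generators and their quasi-linear means *)

Section Generator.
Variables (f : R -> \bar R).
Hypothesis f_mono : strict_monotonic `[0, 1] f.
Hypothesis f_cont : {within `[0, 1], continuous f}.

(** [f z] lies strictly between [f p] and [f q], so it is finite even when these are not. *)
Lemma generator_fin_between p q z : 0 <= p -> q <= 1 -> p < z -> z < q ->
  f z \is a fin_num.
Proof.
move=> p0 q1 pz zq.
have pI : p \in `[0, 1] by rewrite in_itv/=; apply/andP; split; lra.
have qI : q \in `[0, 1] by rewrite in_itv/=; apply/andP; split; lra.
have zI : z \in `[0, 1] by rewrite in_itv/=; apply/andP; split; lra.
rewrite fin_numElt.
case: f_mono => mono.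
- by rewrite (le_lt_trans (leNye _) (mono _ _ pI zI pz))
             (lt_le_trans (mono _ _ zI qI zq) (leey _)).
- by rewrite (le_lt_trans (leNye _) (mono _ _ qI zI zq))
             (lt_le_trans (mono _ _ zI pI pz) (leey _)).
Qed.

Lemma generator_fin_oo z : z \in `]0, 1[ -> f z \is a fin_num.
Proof. by rewrite in_itv/= => /andP[]; exact: generator_fin_between. Qed.

Lemma generator_fin_cc p q z : 0 <= p -> q <= 1 ->
  f p \is a fin_num -> f q \is a fin_num -> z \in `[p, q] -> f z \is a fin_num.
Proof.
move=> p0 q1 fp fq; rewrite in_itv/= !le_eqVlt => /andP[].
move=> /orP[/eqP<-//|pz] /orP[/eqP->//|zq].
exact: (generator_fin_between p0 q1 pz).
Qed.

Lemma hat_mono p q : 0 <= p -> q <= 1 ->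
  f p \is a fin_num -> f q \is a fin_num -> strict_monotonic `[p, q] (hat f).
Proof.
move=> p0 q1 fp fq.
have f_fin z : z \in `[p, q] -> f z \is a fin_num by exact: generator_fin_cc.
have pq01 : {subset `[p, q] <= `[0, 1]}.
  by move=> z; rewrite !in_itv/= => /andP[pz zq]; apply/andP; split; lra.
have := strict_monotonicS pq01 f_mono.
by case=> mono; [left|right] => x y xI yI xy; rewrite /hat -lte_fin !fineK ?f_fin//;
  exact: mono.
Qed.

Lemma hat_cont p q : 0 <= p -> q <= 1 ->
  f p \is a fin_num -> f q \is a fin_num -> {within `[p, q], continuous (hat f)}.
Proof.
move=> p0 q1 fp fq.
have pq01 : `[p, q] `<=` `[0, 1].
  by apply: subset_itvScc; rewrite bnd_simp.
have := continuous_subspaceW pq01 f_cont => /subspace_continuousP fc.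
apply/subspace_continuousP => z zI; apply: fine_cvg; rewrite fineK; first exact: fc.
exact: generator_fin_cc zI.
Qed.

Lemma hat_mono_oo : strict_monotonic `]0, 1[ (hat f).
Proof.
have oo01 : {subset `]0 : R, 1 : R[ <= `[0, 1]}.
  by move=> z; exact: subset_itv_oo_cc.
have := strict_monotonicS oo01 f_mono.
by case=> mono; [left|right] => x y xI yI xy;
  rewrite /hat -lte_fin !fineK ?generator_fin_oo//; exact: mono.
Qed.

Lemma hat_continuous z : z \in `]0, 1[ -> {for z, continuous (hat f)}.
Proof.
move=> zI; apply: fine_cvg; rewrite fineK ?generator_fin_oo//.
have oo01 : `]0 : R, 1 : R[ `<=` `[0, 1] by exact: subset_itv_oo_cc.
have := continuous_subspaceW oo01 f_cont.
rewrite continuous_open_subspace; last exact: interval_open.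
by apply; rewrite inE.
Qed.

Variables (w : R) (w01 : 0 < w < 1).

(** An infinite sum is the value of [f] at an end, a finite one an intermediate value of [hat f].
    The default value of the partial inverse is therefore never taken. *)
Lemma wsum_range u : exists2 z, z \in `[0, 1] & f z = wsum w f u.
Proof.
have [lo0 lohi hi1] := Int01P u.
have [fin|/(wsum_infty w01)[->|->]] := boolP (wsum w f u \is a fin_num); last 2 first.
- by exists (lo u); rewrite ?lo_in01.
- by exists (hi u); rewrite ?hi_in01.
move: (fin); rewrite wsum_fin_num// => /andP[flo fhi].
move: lohi; rewrite le_eqVlt => /orP[/eqP lohi|lohi].
  by exists (lo u); rewrite ?lo_in01// wsum_diag.
have [z zI fz] := IVT_conv lohi (hat_cont lo0 hi1 flo fhi) w01.
exists z; last first.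
  by rewrite wsum_fine// -fz /hat fineK//; apply: generator_fin_cc zI.
by move: zI; rewrite !in_itv/= => /andP[? ?]; apply/andP; split; lra.
Qed.

Lemma qlm_spec u : quasi_linear_mean w f u \in `[0, 1] /\
  f (quasi_linear_mean w f u) = wsum w f u.
Proof.
have [z zI fz] := wsum_range u.
suff -> : quasi_linear_mean w f u = z by [].
rewrite /quasi_linear_mean -/(wsum w f u) -fz pinvKV ?inE//.
move=> x y; rewrite !inE; exact: (strict_monotonic_inj f_mono).
Qed.

Lemma qlm_eq u x : quasi_linear_mean w f u = quasi_linear_mean w f x <->
  wsum w f u = wsum w f x.
Proof.
have [uI fu] := qlm_spec u; have [xI fx] := qlm_spec x.
split=> [ux|]; first by rewrite -fu -fx ux.
by rewrite -fu -fx; exact: (strict_monotonic_inj f_mono).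
Qed.

Lemma qlm_diag u : lo u = hi u -> quasi_linear_mean w f u = lo u.
Proof.
move=> lohi; have [uI fu] := qlm_spec u.
by apply: (strict_monotonic_inj f_mono) => //; rewrite ?lo_in01// fu wsum_diag.
Qed.

Lemma aggregation_qlm : aggregation_function (quasi_linear_mean w f).
Proof.
split.
- by move=> u; have [+ _] := qlm_spec u; rewrite in_itv.
- by rewrite qlm_diag.
- by rewrite qlm_diag.
- move=> u x /andP[lole hile].
  have [uI fu] := qlm_spec u; have [xI fx] := qlm_spec x.
  (* A decreasing [f] reverses the order of the sums, and passing back to the means reverses it
     again. *)
  case: f_mono => mono.
  + rewrite leNgt; apply/negP => /(mono _ _ xI uI); apply/negP.
    have mono_le := ltW_homo_in mono.
    by rewrite -leNgt fu fx le_wsum// mono_le ?lo_in01 ?hi_in01.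
  + rewrite leNgt; apply/negP => /(mono _ _ uI xI); apply/negP.
    have mono_le := ltW_nhomo_in mono.
    by rewrite -leNgt fu fx le_wsum// mono_le ?lo_in01 ?hi_in01.
Qed.

End Generator.

End QuasiLinear.

(** * Admissibility as joint injectivity *)

Section Comparison.
Variable R : realType.
Implicit Types (A B : Int01 R -> R) (psi : R -> R).

Lemma admissible_pairP A B :
    aggregation_function A -> aggregation_function B ->
  admissible_pair A B <-> (forall u x, A u = A x -> B u = B x -> u = x).
Proof.
move=> A_agg B_agg; split=> [[_ _ [_ anti _ _ _]] u x Aux Bux|AB_inj].
  by apply: anti; rewrite /Defs.le_pair Aux Bux eqxx lexx orbT.
split=> //; split.
- by move=> u; rewrite /Defs.le_pair eqxx lexx orbT.
- move=> u x; rewrite /Defs.le_pair; case: (ltgtP (A u) (A x)) => //= Aux Bux.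
  by apply: AB_inj => //; exact: le_anti.
- move=> y x z; rewrite /Defs.le_pair.
  case: (ltgtP (A x) (A y)) => //= [xy _|-> Bxy].
    by case: (ltgtP (A y) (A z)) => //= [yz _|<- _]; rewrite ?(lt_trans xy yz) ?xy.
  by case: (ltgtP (A y) (A z)) => //= _; exact: le_trans Bxy.
- move=> u x; rewrite /Defs.le_pair; case: (ltgtP (A u) (A x)) => //= _.
  exact: le_total.
- move=> u x ux; rewrite /Defs.le_pair.
  have [_ _ _ /(_ _ _ ux)] := A_agg; have [_ _ _ /(_ _ _ ux) ->] := B_agg.
  by rewrite andbT le_eqVlt orbC.
Qed.

(** * Strict convexity and chords at a single weight *)

Variables (f : R -> \bar R).
Hypothesis f_mono : strict_monotonic `[0, 1] f.
Hypothesis f_cont : {within `[0, 1], continuous f}.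

Let phi := hat f.
Let phi_inv := 'pinv_(fun=> 0) `]0, 1[ phi.

Let phi_invK z : z \in `]0, 1[ -> phi_inv (phi z) = z.
Proof.
move=> zI; apply: pinvKV; last by rewrite inE.
by move=> x y; rewrite !inE; apply: (strict_monotonic_inj (hat_mono_oo f_mono)).
Qed.

Let phi_inv_continuous z : z \in `]0, 1[ -> {for phi z, continuous phi_inv}.
Proof.
move=> zI.
suff : {near phi z, continuous phi_inv} by exact: nbhs_singleton.
apply: near_can_continuous.
- near=> x; apply: phi_invK; near: x; exact: near_in_itvoo.
- near=> x; apply: (hat_continuous f_mono f_cont); near: x; exact: near_in_itvoo.
Unshelve. all: by end_near. Qed.

Let sub_oo (p q : R) : p \in `]0, 1[ -> q \in `]0, 1[ -> {subset `[p, q] <= `]0, 1[}.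
Proof. by move=> + + z; rewrite !in_itv/= => ? ? ?; apply/andP; split; lra. Qed.

Let sub_oo' (p q : R) : 0 <= p -> q <= 1 -> {subset `]p, q[ <= `]0, 1[}.
Proof. by move=> ? ? z; rewrite !in_itv/= => ?; apply/andP; split; lra. Qed.

(** The intermediate value theorem gives [z] in the closed interval; an end would force [t = 0] or
    [t = 1], since [phi p] and [phi q] differ. *)
Lemma hat_conv p q t : p \in `]0, 1[ -> q \in `]0, 1[ -> p < q -> 0 < t < 1 ->
  exists2 z, z \in `]p, q[ & phi z = (1 - t) * phi p + t * phi q.
Proof.
move=> pI qI pq t01.
have [p0 q1] : 0 <= p /\ q <= 1.
  by move: pI qI; rewrite !in_itv/=; lra.
have fp := generator_fin_oo f_mono pI; have fq := generator_fin_oo f_mono qI.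
have [z zI phiz] := IVT_conv pq (hat_cont f_mono f_cont p0 q1 fp fq) t01.
exists z => //; have [t0 t1] : t != 0 /\ 1 - t != 0 by split; lra.
have phi_neq : phi q - phi p != 0.
  rewrite subr_eq0; apply/eqP => /(strict_monotonic_inj (hat_mono_oo f_mono)) qp.
  by move: pq; rewrite qp ?ltxx.
move: zI; rewrite !in_itv/= !lt_neqAle => /andP[-> ->]; rewrite !andbT.
apply/andP; split; apply/eqP => zE; move: phiz; rewrite -/phi.
- rewrite -zE => /eqP; rewrite -subr_eq0.
  rewrite (_ : _ - _ = - (t * (phi q - phi p))); last by rewrite -/phi; ring.
  by rewrite oppr_eq0 mulf_eq0 (negbTE t0) (negbTE phi_neq).
- rewrite zE => /eqP; rewrite -subr_eq0.
  rewrite (_ : _ - _ = (1 - t) * (phi q - phi p)); last by rewrite -/phi; ring.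
  by rewrite mulf_eq0 (negbTE t1) (negbTE phi_neq).
Qed.

(** This is strict convexity at the parameter [w]. Leaving [psi] free covers [hat g] and its
    opposite, the latter for concavity. *)
Lemma strictly_convex_on_convex_wrt psi w : 0 < w < 1 ->
  strictly_convex_on (hat_range f) (psi \o phi_inv) -> convex_wrt w `]0, 1[ phi psi.
Proof.
move=> w01 h_convex a b c aI bI cI ab phic.
have := h_convex (phi a) (phi b) w; rewrite -phic /= !phi_invK//; apply=> //.
- by exists a.
- by exists b.
- apply/eqP => /(strict_monotonic_inj (hat_mono_oo f_mono)) abE.
  by move: ab; rewrite abE// ltxx.
Qed.

(** [chord_lt] on each closed subinterval passes from the weight [w] to every [t]. *)
Lemma convex_wrt_strictly_convex_on psi w : 0 < w < 1 ->
    {in `]0, 1[, continuous psi} -> convex_wrt w `]0, 1[ phi psi ->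
  strictly_convex_on (hat_range f) (psi \o phi_inv).
Proof.
move=> w01 psi_cont psi_below.
have lt_conv p q t : p \in `]0, 1[ -> q \in `]0, 1[ -> p < q -> 0 < t < 1 ->
    psi (phi_inv ((1 - t) * phi p + t * phi q)) < (1 - t) * psi p + t * psi q.
  move=> pI qI pq t01; have [z zI phiz] := hat_conv pI qI pq t01.
  have [p0 q1] : 0 <= p /\ q <= 1 by move: pI qI; rewrite !in_itv/=; lra.
  have oo01 := sub_oo' p0 q1.
  have fp := generator_fin_oo f_mono pI; have fq := generator_fin_oo f_mono qI.
  rewrite -phiz phi_invK ?oo01//.
  have := chord_lt pq w01 (hat_mono f_mono p0 q1 fp fq)
    (hat_cont f_mono f_cont p0 q1 fp fq).
  apply; last exact: phiz.
  - by apply: continuous_in_subspaceT => x; rewrite inE/= => /(sub_oo pI qI)/psi_cont.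
  - by move=> a b c /oo01 aI /oo01 bI /oo01 cI; exact: psi_below.
  - exact: zI.
move=> _ _ t [p pI <-] [q qI <-] pq t01 /=; rewrite !phi_invK//.
have [pq'|qp|pqE] := ltgtP p q; first exact: lt_conv.
- have t01' : 0 < 1 - t < 1 by lra.
  by have := lt_conv q p _ qI pI qp t01'; rewrite subKr addrC [ltRHS]addrC.
- by rewrite pqE eqxx in pq.
Qed.

(* The defect [psi c - (1 - w) psi a - w psi b] does not vanish on the triangle
   of pairs [a < b], so it has constant sign on this connected set. *)
Lemma convex_wrt_or_opp psi w : 0 < w < 1 -> {in `]0, 1[, continuous psi} ->
    (forall a b c, a \in `]0, 1[ -> b \in `]0, 1[ -> c \in `]0, 1[ -> a < b ->
      phi c = (1 - w) * phi a + w * phi b ->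
      psi c != (1 - w) * psi a + w * psi b) ->
  convex_wrt w `]0, 1[ phi psi \/ convex_wrt w `]0, 1[ phi (\- psi).
Proof.
move=> w01 psi_cont psi_neq; apply: contrapT => /not_orP[].
move=> /existsNP[a] /existsNP[b] /existsNP[c] /not_implyP[aI] /not_implyP[bI].
move=> /not_implyP[cI] /not_implyP[ab] /not_implyP[phic] /negP.
rewrite -leNgt => psic.
move=> /existsNP[a'] /existsNP[b'] /existsNP[c'] /not_implyP[a'I] /not_implyP[b'I].
move=> /not_implyP[c'I] /not_implyP[ab'] /not_implyP[phic'] /negP.
rewrite -leNgt /= => psic'.
(* A segment in the triangle of pairs joins the two counterexamples; [y_ s] is the value of [phi] at
   the mean of [a_ s] and [b_ s], and [E s] is the defect there. *)
pose a_ s := a + s * (a' - a); pose b_ s := b + s * (b' - b).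
pose y_ s := (1 - w) * phi (a_ s) + w * phi (b_ s).
pose E s := psi (phi_inv (y_ s)) - ((1 - w) * psi (a_ s) + w * psi (b_ s)).
have path_cont (v v' : R) : continuous (fun s : R => v + s * (v' - v)).
  move=> s; apply: cvgD; first exact: cvg_cst.
  by apply: cvgM; [exact: cvg_id|exact: cvg_cst].
(* The point is [(1 - s) * v + s * v']; the first term is positive for [s <= 1 / 2], the second one
   beyond. *)
have path_gt0 (v v' s : R) : 0 < v -> 0 < v' -> s \in `[0, 1] -> 0 < v + s * (v' - v).
  rewrite in_itv/= => v0 v'0 /andP[s0 s1].
  have [s1'|s1'] := leP s (1 / 2).
    by have := mulr_ge0 s0 (ltW v'0); have : 0 < (1 - s) * v; [apply: mulr_gt0|]; lra.
  have : 0 < s * v' by apply: mulr_gt0; lra.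
  by have : 0 <= (1 - s) * v; [apply: mulr_ge0|]; lra.
have path_in (v v' s : R) : v \in `]0, 1[ -> v' \in `]0, 1[ -> s \in `[0, 1] ->
    v + s * (v' - v) \in `]0, 1[.
  rewrite [v \in _]in_itv [v' \in _]in_itv/= => /andP[v0 v1] /andP[v'0 v'1] sI.
  have := @path_gt0 (1 - v) (1 - v') _ _ _ sI; have := path_gt0 _ _ _ v0 v'0 sI.
  by rewrite in_itv/= => ? gt0; apply/andP; split=> //; move: gt0; rewrite !subr_gt0; lra.
(* [b_ s - a_ s] itself moves along the segment from [b - a] to [b' - a']. *)
have ab_ s : s \in `[0, 1] -> a_ s < b_ s.
  move=> sI; rewrite -subr_gt0 /a_ /b_.
  have := path_gt0 (b - a) (b' - a') s; rewrite !subr_gt0 => /(_ ab ab' sI).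
  by lra.
have y_in s : s \in `[0, 1] -> exists2 z, z \in `]0, 1[ & phi z = y_ s.
  move=> sI; have aI_ := path_in a a' s aI a'I sI; have bI_ := path_in b b' s bI b'I sI.
  have [z zI phiz] := hat_conv aI_ bI_ (ab_ _ sI) w01; exists z => //.
  by apply: sub_oo' zI; move: aI_ bI_; rewrite !in_itv/=; lra.
have E_cont : {within `[0, 1], continuous E}.
  apply: continuous_in_subspaceT => s; rewrite inE/= => sI.
  have aI_ := path_in a a' s aI a'I sI; have bI_ := path_in b b' s bI b'I sI.
  have [z zI phiz] := y_in s sI.
  have comp_cont (h : R -> R) (v v' : R) :
      {for v + s * (v' - v), continuous h} ->
      {for s, continuous (fun s : R => h (v + s * (v' - v)))}.
    by move=> h_cont; apply: (continuous_comp (path_cont v v' s)).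
  have conv_cont (h : R -> R) : {in `]0, 1[, continuous h} ->
      {for s, continuous (fun s : R => (1 - w) * h (a_ s) + w * h (b_ s))}.
    move=> h_cont; apply: cvgD; apply: cvgM;
      try exact: cvg_cst; apply: comp_cont; exact: h_cont.
  apply: cvgB; last exact: conv_cont.
  apply: continuous_comp; last first.
    by rewrite -phiz phi_invK//; exact: psi_cont.
  apply: (@continuous_comp _ _ _ y_ phi_inv).
    by apply: conv_cont => x; exact: hat_continuous.
  by rewrite -phiz; exact: phi_inv_continuous.
have E0 : 0 <= E 0.
  by rewrite /E /y_ /a_ /b_ !mul0r !addr0 -phic phi_invK// subr_ge0.
have E1 : E 1 <= 0.
  rewrite /E /y_ /a_ /b_ !mul1r !subrKC -phic' phi_invK// subr_le0.
  by move: psic'; lra.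
(* A zero of [E] is a pair without defect, against [psi_neq]. *)
have [|s sI Es] := @IVT R E 0 1 0 ler01 E_cont.
  by rewrite ge_min le_max E0 E1 orbT.
have [z zI phiz] := y_in s sI.
have /eqP := psi_neq _ _ _ (path_in a a' s aI a'I sI) (path_in b b' s bI b'I sI)
  zI (ab_ s sI) phiz.
by apply; apply/eqP; rewrite -subr_eq0 -Es /E -phiz phi_invK.
Qed.

End Comparison.

(** * Infinite weighted sums *)

Section Means.
Variable R : realType.
Implicit Types (f g : R -> \bar R) (w : R) (u x : Int01 R).

Lemma mine_abse_lt (a b : \bar R) :
  (mine `|a| `|b| < +oo)%E = (a \is a fin_num) || (b \is a fin_num).
Proof. by rewrite gt_min -!ge0_fin_numE// !abse_fin_num. Qed.

Lemma wsum_lo_infty w f u : 0 < w < 1 -> f (lo u) \isn't a fin_num ->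
  f (hi u) \is a fin_num -> wsum w f u = f (lo u).
Proof.
move=> w01 flo fhi.
have fu : wsum w f u \isn't a fin_num by rewrite wsum_fin_num// negb_and flo.
have [//|E] := wsum_infty w01 fu.
by rewrite E fhi in fu.
Qed.

Lemma wsum_hi_infty w f u : 0 < w < 1 -> f (hi u) \isn't a fin_num ->
  f (lo u) \is a fin_num -> wsum w f u = f (hi u).
Proof.
move=> w01 fhi flo.
have fu : wsum w f u \isn't a fin_num by rewrite wsum_fin_num// negb_and fhi orbT.
have [E|//] := wsum_infty w01 fu.
by rewrite E flo in fu.
Qed.

(** An infinite sum is the value of [f] at an end of each interval; injectivity makes the two ends
    one point, which is [0] or [1] because [f] is finite inside. *)
Lemma wsum_infty_eq w f u x : 0 < w < 1 -> strict_monotonic `[0, 1] f ->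
    wsum w f u = wsum w f x -> wsum w f u \isn't a fin_num ->
  [/\ lo u = lo x, lo u = 0 & f 0 \isn't a fin_num] \/
  [/\ hi u = hi x, hi u = 1 & f 1 \isn't a fin_num].
Proof.
move=> w01 f_mono ux fu.
have ends y : wsum w f y \isn't a fin_num ->
    exists z, [/\ (z = lo y) \/ (z = hi y), z \in `[0, 1] & wsum w f y = f z].
  move=> /(wsum_infty w01)[]E; [exists (lo y)|exists (hi y)];
    split=> //; by [left|right|exact: lo_in01|exact: hi_in01].
have [z [zu zI fz]] := ends _ fu.
have [z' [zx zI' fz']] : exists z,
    [/\ (z = lo x) \/ (z = hi x), z \in `[0, 1] & wsum w f x = f z].
  by apply: ends; rewrite -ux.
have zz' : z = z'.
  by apply: (strict_monotonic_inj f_mono) => //; rewrite -fz -fz'.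
have {}fz : f z \isn't a fin_num by rewrite -fz.
have [ulo luh uhi] := Int01P u; have [xlo lxh xhi] := Int01P x.
have [z0|z1] : z = 0 \/ z = 1.
  have := contra (generator_fin_oo f_mono (z := z)) fz.
  move: zI; rewrite !in_itv/= => /andP[z0 z1]; rewrite negb_and -!leNgt.
  by move=> /orP[z0'|z1']; [left|right]; apply/eqP; rewrite eq_le; apply/andP.
- by left; rewrite -z0; split=> //; move: zu zx; rewrite -zz' z0; lra.
- by right; rewrite -z1; split=> //; move: zu zx; rewrite -zz' z1; lra.
Qed.

(** * Necessity of the three conditions *)

Variables (w : R) (f g : R -> \bar R).
Hypothesis w01 : 0 < w < 1.
Hypothesis f_mono : strict_monotonic `[0, 1] f.
Hypothesis f_cont : {within `[0, 1], continuous f}.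
Hypothesis g_mono : strict_monotonic `[0, 1] g.
Hypothesis g_cont : {within `[0, 1], continuous g}.

Definition wsum_inj :=
  forall u x, wsum w f u = wsum w f x -> wsum w g u = wsum w g x -> u = x.

Lemma admissible_wsum_inj :
  admissible_pair (quasi_linear_mean w f) (quasi_linear_mean w g) <-> wsum_inj.
Proof.
rewrite admissible_pairP; try exact: aggregation_qlm.
by split=> inj u x fux gux; apply: inj; apply/qlm_eq.
Qed.

(** If both generators are infinite at [0], this value absorbs the other term, so [[0, 1/2]] and
    [[0, 1/3]] have the same sums. *)
Lemma wsum_inj_end0 : wsum_inj -> (f 0 \is a fin_num) || (g 0 \is a fin_num).
Proof.
move=> inj; rewrite -[_ || _]negbK negb_or; apply/negP => /andP[f0 g0].
have [|||u [ulo uhi]] := @Int01_ex R 0 (1 / 2); try lra.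
have [|||x [xlo xhi]] := @Int01_ex R 0 (1 / 3); try lra.
have uI : hi u \in `]0, 1[ by rewrite uhi in_itv/=; apply/andP; split; lra.
have xI : hi x \in `]0, 1[ by rewrite xhi in_itv/=; apply/andP; split; lra.
have eq_wsum (k : R -> \bar R) : strict_monotonic `[0, 1] k ->
    k 0 \isn't a fin_num -> wsum w k u = wsum w k x.
  move=> k_mono k0; have kI := generator_fin_oo k_mono.
  by rewrite (wsum_lo_infty w01 _ (kI _ uI)) ?(wsum_lo_infty w01 _ (kI _ xI)) ?ulo ?xlo.
have ux : u = x by apply: inj; exact: eq_wsum.
by move: xhi; rewrite -ux uhi; lra.
Qed.

Lemma wsum_inj_end1 : wsum_inj -> (f 1 \is a fin_num) || (g 1 \is a fin_num).
Proof.
move=> inj; rewrite -[_ || _]negbK negb_or; apply/negP => /andP[f1 g1].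
have [|||u [ulo uhi]] := @Int01_ex R (1 / 2) 1; try lra.
have [|||x [xlo xhi]] := @Int01_ex R (1 / 3) 1; try lra.
have uI : lo u \in `]0, 1[ by rewrite ulo in_itv/=; apply/andP; split; lra.
have xI : lo x \in `]0, 1[ by rewrite xlo in_itv/=; apply/andP; split; lra.
have eq_wsum (k : R -> \bar R) : strict_monotonic `[0, 1] k ->
    k 1 \isn't a fin_num -> wsum w k u = wsum w k x.
  move=> k_mono k1; have kI := generator_fin_oo k_mono.
  by rewrite (wsum_hi_infty w01 _ (kI _ uI)) ?(wsum_hi_infty w01 _ (kI _ xI)) ?uhi ?xhi.
have ux : u = x by apply: inj; exact: eq_wsum.
by move: xlo; rewrite -ux ulo; lra.
Qed.

Lemma wsum_inj_convex_wrt : wsum_inj ->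
  convex_wrt w `]0, 1[ (hat f) (hat g) \/ convex_wrt w `]0, 1[ (hat f) (\- hat g).
Proof.
move=> inj; apply: convex_wrt_or_opp => //.
  by move=> z zI; exact: hat_continuous.
move=> a b c aI bI cI ab fc; apply/eqP => gc.
move: (aI) (bI) (cI); rewrite !in_itv/= => /andP[a0 a1] /andP[b0 b1] /andP[c0 c1].
have [u [ulo uhi]] := Int01_ex (ltW a0) (ltW ab) (ltW b1).
have [x [xlo xhi]] := Int01_ex (ltW c0) (lexx c) (ltW c1).
have : u = x.
  by apply: inj; rewrite (@wsum_diag _ _ w01 _ x) ?xlo ?xhi// wsum_fine ?ulo ?uhi
    ?(generator_fin_oo f_mono) ?(generator_fin_oo g_mono)// -?fc -?gc fineK
    ?(generator_fin_oo f_mono) ?(generator_fin_oo g_mono).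
by move=> ux; move: ab; rewrite -ulo -uhi ux xlo xhi ltxx.
Qed.

Lemma wsum_fin_eq u x : wsum w f u = wsum w f x -> wsum w f u \is a fin_num ->
  (1 - w) * hat f (lo u) + w * hat f (hi u) =
  (1 - w) * hat f (lo x) + w * hat f (hi x).
Proof.
move=> fux fu; have fx : wsum w f x \is a fin_num by rewrite -fux.
move: (fu) (fx); rewrite !wsum_fin_num// => /andP[? ?] /andP[? ?].
by move: fux; rewrite !wsum_fine// => -[].
Qed.

End Means.

(** * Sufficiency of the three conditions *)

Section Sufficiency.
Variable R : realType.
Implicit Types (u x : Int01 R).
Variables (w : R) (f g : R -> \bar R).
Hypothesis w01 : 0 < w < 1.
Hypothesis f_mono : strict_monotonic `[0, 1] f.
Hypothesis f_cont : {within `[0, 1], continuous f}.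
Hypothesis g_mono : strict_monotonic `[0, 1] g.
Hypothesis g_cont : {within `[0, 1], continuous g}.

(** Otherwise both ends of [x] would be at least those of [u], the left one strictly larger, and
    strict monotonicity would separate the sums. *)
Lemma wsum_fin_nested u x : wsum w f u = wsum w f x -> wsum w f u \is a fin_num ->
  lo u < lo x -> hi x < hi u.
Proof.
move=> fux fu lolt; rewrite ltNge; apply/negP => hile.
have fx : wsum w f x \is a fin_num by rewrite -fux.
have := wsum_fin_eq w01 fux fu.
move: fu fx; rewrite !wsum_fin_num// => /andP[fulo fuhi] /andP[fxlo fxhi].
have [ulo luh uhi] := Int01P u; have [xlo lxh xhi] := Int01P x.
(* [[lo u, hi x]] contains all four ends, and [f] is finite on it because it is finite at [lo u] and
   [hi x]. *)
have loI : lo u \in `[lo u, hi x] by rewrite in_itv/=; apply/andP; split; lra.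
have loI' : lo x \in `[lo u, hi x] by rewrite in_itv/=; apply/andP; split; lra.
have hiI : hi u \in `[lo u, hi x] by rewrite in_itv/=; apply/andP; split; lra.
have hiI' : hi x \in `[lo u, hi x] by rewrite in_itv/=; apply/andP; split; lra.
have [w0 w1] : 0 < w /\ 0 < 1 - w by rewrite subr_gt0; apply/andP.
case: (hat_mono f_mono ulo xhi fulo fxhi) => mono /eqP.
- by rewrite lt_eqF// ltr_leD// ?ltr_pM2l ?ler_pM2l ?mono ?(ltW_homo_in mono).
- by rewrite gt_eqF// ltr_leD// ?ltr_pM2l ?ler_pM2l ?mono ?(ltW_nhomo_in mono).
Qed.

Lemma convex_wrt_wsum_nlt u x :
  convex_wrt w `]0, 1[ (hat f) (hat g) \/ convex_wrt w `]0, 1[ (hat f) (\- hat g) ->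
  wsum w f u = wsum w f x -> wsum w g u = wsum w g x ->
  wsum w f u \is a fin_num -> wsum w g u \is a fin_num -> ~ lo u < lo x.
Proof.
move=> fg_below fux gux fu gu lolt; have hilt := wsum_fin_nested fux fu lolt.
have fE := wsum_fin_eq w01 fux fu; have gE := wsum_fin_eq w01 gux gu.
move: fu gu; rewrite !wsum_fin_num// => /andP[fulo fuhi] /andP[gulo guhi].
have [ulo luh uhi] := Int01P u; have [xlo lxh xhi] := Int01P x.
have sub01 : {subset `]lo u, hi u[ <= `]0, 1[}.
  by apply: subset_itv; rewrite bnd_simp.
have g_cont' := hat_cont g_mono g_cont ulo uhi gulo guhi.
have lt_of psi : {within `[lo u, hi u], continuous psi} ->
    convex_wrt w `]0, 1[ (hat f) psi ->
    (1 - w) * psi (lo x) + w * psi (hi x) < (1 - w) * psi (lo u) + w * psi (hi u).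
  (* [[lo u, hi u]] may reach [0] or [1], but the chord hypothesis is required on its interior
     only. *)
  move=> psi_cont psi_below; apply: (convex_wrt_nested w01 lolt lxh hilt
    (hat_mono f_mono ulo uhi fulo fuhi)
    (hat_cont f_mono f_cont ulo uhi fulo fuhi) psi_cont _ fE).
  by move=> a b c /sub01 aI /sub01 bI /sub01 cI; exact: psi_below.
case: fg_below => /lt_of.
- by move=> /(_ g_cont'); rewrite gE ltxx.
- have gN_cont : {within `[lo u, hi u], continuous \- hat g}.
    by move=> y; apply: cvgN; exact: g_cont'.
  by move=> /(_ gN_cont) /=; lra.
Qed.

Lemma convex_wrt_wsum_inj :
  (f 0 \is a fin_num) || (g 0 \is a fin_num) ->
  (f 1 \is a fin_num) || (g 1 \is a fin_num) ->
  convex_wrt w `]0, 1[ (hat f) (hat g) \/ convex_wrt w `]0, 1[ (hat f) (\- hat g) ->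
  wsum_inj w f g.
Proof.
move=> fg0 fg1 fg_below u x fux gux.
have [w_neq0 w'_neq0] : w != 0 /\ 1 - w != 0.
  by case/andP: w01 => w0 w1; rewrite !gt_eqF ?subr_gt0.
(* A common end and a finite sum determine the other end. *)
have eq_fin (h : R -> \bar R) : strict_monotonic `[0, 1] h ->
    wsum w h u = wsum w h x -> wsum w h u \is a fin_num ->
    lo u = lo x \/ hi u = hi x -> u = x.
  move=> h_mono hux hu; have hx : wsum w h x \is a fin_num by rewrite -hux.
  have := wsum_fin_eq w01 hux hu.
  move: hu hx; rewrite !wsum_fin_num// => /andP[hulo huhi] /andP[hxlo hxhi].
  move=> E [lo_eq|hi_eq]; apply: Int01_eq => //.
  - apply: (strict_monotonic_inj h_mono); rewrite ?hi_in01//.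
    rewrite -(fineK huhi) -(fineK hxhi); congr EFin.
    by move: E; rewrite lo_eq => /addrI /(mulfI w_neq0).
  - apply: (strict_monotonic_inj h_mono); rewrite ?lo_in01//.
    rewrite -(fineK hulo) -(fineK hxlo); congr EFin.
    by move: E; rewrite hi_eq => /addIr /(mulfI w'_neq0).
(* Two finite sums leave the nested case. If just one is infinite, it yields a common end, and
   [eq_fin] for the other one concludes. *)
have [fu|fu] := boolP (wsum w f u \is a fin_num);
  have [gu|gu] := boolP (wsum w g u \is a fin_num).
- have [lolt|lolt|lo_eq] := ltgtP (lo u) (lo x); last by apply: (eq_fin f); auto.
  + by case: (convex_wrt_wsum_nlt fg_below fux gux fu gu lolt).
  + by case: (convex_wrt_wsum_nlt fg_below (esym fux) (esym gux) _ _ lolt);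
      rewrite -?fux -?gux.
- by apply: (eq_fin f) => //;
    have [[]|[]] := wsum_infty_eq w01 g_mono gux gu; [left|right].
- by apply: (eq_fin g) => //;
    have [[]|[]] := wsum_infty_eq w01 f_mono fux fu; [left|right].
(* With both sums infinite, [fg0] and [fg1] exclude that [f] and [g] are infinite at the same end,
   so both ends are shared. *)
- have [[lo_eq lo0 f0]|[hi_eq hi1 f1]] := wsum_infty_eq w01 f_mono fux fu;
  have [[lo_eq' lo0' g0]|[hi_eq' hi1' g1]] := wsum_infty_eq w01 g_mono gux gu.
  + by rewrite (negbTE f0) (negbTE g0) in fg0.
  + exact: Int01_eq.
  + exact: Int01_eq.
  + by rewrite (negbTE f1) (negbTE g1) in fg1.
Qed.

End Sufficiency.

(** * Assembling the two implications *)

Theorem corollary4p4 (R : realType) (w1 w2 : R) (f g : R -> \bar R)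
    (hw1 : 0 < w1 < 1) (hw2 : 0 < w2 < 1) (hw : w1 = w2)
    (f_mono : strict_monotonic `[0, 1] f) (f_cont : {within `[0, 1], continuous f})
    (g_mono : strict_monotonic `[0, 1] g) (g_cont : {within `[0, 1], continuous g}) :
  admissible_pair (quasi_linear_mean w1 f) (quasi_linear_mean w2 g) <->
  [/\ (mine `|f 0%R| `|g 0%R| < +oo)%E,
      (mine `|f 1%R| `|g 1%R| < +oo)%E
    & strictly_convex_on (hat_range f) (hat_comp g f) \/
      strictly_concave_on (hat_range f) (hat_comp g f)].
Proof.
rewrite -hw !mine_abse_lt admissible_wsum_inj//.
have concaveE : strictly_concave_on (hat_range f) (hat_comp g f) <->
    strictly_convex_on (hat_range f) (\- hat_comp g f).
  by split=> h x y t xD yD xy t01; have := h x y t xD yD xy t01 => /=; lra.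
have g_cont' : {in `]0, 1[, continuous (hat g)}.
  by move=> z zI; exact: hat_continuous.
split=> [inj|[fg0 fg1 fg_conv]].
- split; [exact: wsum_inj_end0 inj|exact: wsum_inj_end1 inj|].
  have [fg|fg] := wsum_inj_convex_wrt hw1 f_mono f_cont g_mono g_cont inj; [left|right].
  (* [hat_comp g f] unfolds to [hat g] composed with the partial inverse of [hat f]. *)
  + exact: (convex_wrt_strictly_convex_on f_mono f_cont hw1 g_cont' fg).
  + apply/concaveE; apply: (convex_wrt_strictly_convex_on f_mono f_cont hw1 _ fg).
    by move=> z zI; apply: cvgN; exact: g_cont'.
- apply: convex_wrt_wsum_inj => //.
  by case: fg_conv => [fg|/concaveE fg]; [left|right];
    exact: (strictly_convex_on_convex_wrt f_mono hw1 fg).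
Qed.
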